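(* Let $n\ge2$. The representation $\overline{\boldsymbol N}_{n,2,0}$ of the braid group $B_n$ is faithful on the subgroup $\langle\Delta_n\rangle$. In particular, for every $k\in\mathbb Z$, $$\Delta_n^k\,b=b+kt\sum_{1\le i<j\le n}w_{i,j}.$$
   Context: $B_n$ is the braid group with Artin generators $\sigma_1,\dots,\sigma_{n-1}$, and $\Delta_n=\delta_n\delta_{n-1}\cdots\delta_2$ with $\delta_i=\sigma_1\sigma_2\cdots\sigma_{i-1}$ (the half twist). $\overline{\boldsymbol N}_{n,2,0}$ is the free $\mathbb Z[t]$-module ($t$ an indeterminate) with basis $b$ and $w_{i,j}$ ($1\le i<j\le n$), with $B_n$-action (the specialization at $q=s=1$ of the three-variable representation $\widetilde{\boldsymbol N}_{n,2,0}$): $\sigma_i w_{j,k}=w_{j,k}$ if $\{i,i+1\}\cap\{j,k\}=\emptyset$; $\sigma_i w_{i+1,j}=w_{i,j}$ and $\sigma_i w_{i,j}=w_{i+1,j}$ ($j>i+1$); $\sigma_i w_{j,i+1}=w_{j,i}$ and $\sigma_i w_{j,i}=w_{j,i+1}$ ($j<i$); $\sigma_i w_{i,i+1}=w_{i,i+1}$; $\sigma_i b=b+t\,w_{i,i+1}$. *)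

(* Defs.v *)
From HB Require Import structures.
From mathcomp Require Import all_boot all_order all_algebra.
From mathcomp Require Import zify.
From mathcomp Require Import boolp classical_sets.

Set Implicit Arguments.
Unset Strict Implicit.
Unset Printing Implicit Defensive.

Import Order.TTheory GRing.Theory Num.Theory.

Local Open Scope ring_scope.

Definition expgz (G : groupType) (x : G) (k : int) : G :=
  match k with
  | Posz m => (x ^+ m)%g
  | Negz m => (x ^- m.+1)%g
  end.

Definition subgroup (G : groupType) (H : set G) : Prop :=
  [/\ H 1%g, (forall x y, H x -> H y -> H (x * y)%g)
    & (forall x, H x -> H (x^-1)%g)].

Definition generated (G : groupType) (A : set G) : set G :=
  smallest (@subgroup G) A.

Definition faithful_on (R : nzRingType) (V : lmodType R) (G : groupType)
    (H : set G) (rho : G -> {linear V -> V}) : Prop :=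
  forall x y : G, H x -> H y -> rho x =1 rho y -> x = y.

(* Artin's presentation of B_n. The ordinal [i : 'I_n.-1] stands for the (1-based)
   generator index i+1. A letter [(i, false)] is the generator, and [(i, true)] is
   its inverse. *)
Definition braid_word (n : nat) := seq ('I_n.-1 * bool).

Inductive braid_conv (n : nat) : braid_word n -> braid_word n -> Prop :=
| braid_conv_refl u : braid_conv u u
| braid_conv_sym u v : braid_conv u v -> braid_conv v u
| braid_conv_trans u v w : braid_conv u v -> braid_conv v w -> braid_conv u w
| braid_conv_cat u u' v v' :
    braid_conv u u' -> braid_conv v v' -> braid_conv (u ++ v) (u' ++ v')
| braid_conv_cancel i e : braid_conv [:: (i, e); (i, ~~ e)] [::]
| braid_conv_comm (i j : 'I_n.-1) : (i.+1 < j)%N ->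
    braid_conv [:: (i, false); (j, false)] [:: (j, false); (i, false)]
| braid_conv_braid (i j : 'I_n.-1) : j = i.+1 :> nat ->
    braid_conv [:: (i, false); (j, false); (i, false)]
               [:: (j, false); (i, false); (j, false)].

Definition braid_eqb (n : nat) (u v : braid_word n) : bool :=
  `[< braid_conv u v >].

Section BraidGroup.
Variable n : nat.

Lemma braid_eqb_refl : reflexive (@braid_eqb n).
Proof. by move=> u; apply/asboolP/braid_conv_refl. Qed.

Lemma braid_eqb_sym : symmetric (@braid_eqb n).
Proof.
by move=> u v; apply/asboolP/asboolP; apply: braid_conv_sym.
Qed.

Lemma braid_eqb_trans : transitive (@braid_eqb n).
Proof.
move=> v u w /asboolP uv /asboolP vw; apply/asboolP.
exact: braid_conv_trans vw.
Qed.

Canonical braid_equiv :=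
  EquivRel (@braid_eqb n) braid_eqb_refl braid_eqb_sym braid_eqb_trans.

End BraidGroup.

Definition braid (n : nat) := {eq_quot (braid_equiv n)}%qT.
HB.instance Definition _ n := Choice.on (braid n).
HB.instance Definition _ n := EqQuotient.on (braid n).

Section BraidGroupStructure.
Variable n : nat.
Local Open Scope quotient_scope.
Implicit Types (u v : braid_word n) (x y z : braid n).

Definition braid_class u : braid n := \pi_(braid n) u.

Lemma braid_classP u v : braid_class u = braid_class v <-> braid_conv u v.
Proof.
split=> [/eqmodP/asboolP //|uv]; exact/eqmodP/asboolP.
Qed.

Lemma braid_class_repr x : braid_class (repr x) = x.
Proof. exact: reprK. Qed.

Lemma repr_braid_class u : braid_conv (repr (braid_class u)) u.
Proof. by apply/braid_classP; rewrite braid_class_repr. Qed.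

Definition inv_word u : braid_word n := rev [seq (a.1, ~~ a.2) | a <- u].

Lemma inv_word_cat u v : inv_word (u ++ v) = inv_word v ++ inv_word u.
Proof. by rewrite /inv_word map_cat rev_cat. Qed.

Lemma inv_wordK : involutive inv_word.
Proof.
move=> u; rewrite /inv_word map_rev revK -map_comp.
by rewrite map_id_in // => -[i e] _ /=; rewrite negbK.
Qed.

Lemma cat_inv_word u : braid_conv (u ++ inv_word u) [::].
Proof.
elim: u => [|[i e] u IHu]; first exact: braid_conv_refl.
rewrite -cat1s inv_word_cat -!catA (catA u).
apply: (@braid_conv_trans _ _ ([:: (i, e)] ++ [::] ++ [:: (i, ~~ e)])).
  apply: braid_conv_cat; first exact: braid_conv_refl.
  by apply: braid_conv_cat => //; exact: braid_conv_refl.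
exact: braid_conv_cancel.
Qed.

Lemma inv_word_conv u v : braid_conv u v -> braid_conv (inv_word u) (inv_word v).
Proof.
move=> uv.
have r := @braid_conv_refl n.
apply: (@braid_conv_trans _ _ (inv_word u ++ (v ++ inv_word v))).
  rewrite -[X in braid_conv X _]cats0; apply: braid_conv_cat => //.
  exact/braid_conv_sym/cat_inv_word.
rewrite catA -[X in braid_conv _ X]cat0s; apply: braid_conv_cat => //.
apply: (@braid_conv_trans _ _ (inv_word u ++ u)).
  by apply: braid_conv_cat => //; exact: braid_conv_sym.
by rewrite -{2}[u]inv_wordK; exact: cat_inv_word.
Qed.

Definition braid_mul x y : braid n := braid_class (repr x ++ repr y).
Definition braid_one : braid n := braid_class [::].
Definition braid_inv x : braid n := braid_class (inv_word (repr x)).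

Lemma braid_mulE u v :
  braid_mul (braid_class u) (braid_class v) = braid_class (u ++ v).
Proof.
by apply/braid_classP; apply: braid_conv_cat; exact: repr_braid_class.
Qed.

Lemma braid_invE u : braid_inv (braid_class u) = braid_class (inv_word u).
Proof. by apply/braid_classP/inv_word_conv/repr_braid_class. Qed.

Lemma braid_mulA : associative braid_mul.
Proof.
move=> x y z.
rewrite -[x]braid_class_repr -[y]braid_class_repr -[z]braid_class_repr.
by rewrite !braid_mulE catA.
Qed.

Lemma braid_mul1 : left_id braid_one braid_mul.
Proof. by move=> x; rewrite -[x]braid_class_repr braid_mulE. Qed.

Lemma braid_mulr1 : right_id braid_one braid_mul.
Proof. by move=> x; rewrite -[x]braid_class_repr braid_mulE cats0. Qed.

Lemma braid_mulrV : right_inverse braid_one braid_inv braid_mul.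
Proof.
move=> x; rewrite -[x]braid_class_repr braid_invE braid_mulE.
exact/braid_classP/cat_inv_word.
Qed.

Lemma braid_mulV : left_inverse braid_one braid_inv braid_mul.
Proof.
move=> x; rewrite -[x]braid_class_repr braid_invE braid_mulE.
apply/braid_classP; rewrite -{2}[repr x]inv_wordK; exact: cat_inv_word.
Qed.

End BraidGroupStructure.

HB.instance Definition _ n := isGroup.Build (braid n)
  (@braid_mulA n) (@braid_mul1 n) (@braid_mulr1 n) (@braid_mulV n) (@braid_mulrV n).

Definition sigma (n : nat) (i : 'I_n.-1) : braid n :=
  braid_class [:: (i, false)].

(* The product sigma_1 sigma_2 ... sigma_(m-1), in the 1-based indexing. *)
Definition delta (n m : nat) : braid n :=
  (\prod_(i < n.-1 | (i.+1 < m)%N) sigma i)%g.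

(* The order of the factors is delta_n, delta_(n-1), ..., delta_2. *)
Definition Delta (n : nat) : braid n := (\prod_(i < n.-1) delta n (n - i)%N)%g.

(* [None] indexes the basis vector b, and [Some (j, k)] indexes w_{j,k}. *)
Definition Nindex (n : nat) := option {p : 'I_n * 'I_n | (p.1 < p.2)%N}.

(* The free Z[t]-module on [Nindex n], with Z[t] = {poly int} and t = 'X. *)
Definition Nbar (n : nat) := {ffun Nindex n -> {poly int}^o}.
HB.instance Definition _ n := GRing.Lmodule.on (Nbar n).

Section Representation.
Variable n : nat.
Implicit Types (i : 'I_n.-1) (j k : 'I_n) (e : bool) (v : Nbar n).

Definition basis_vec (x : Nindex n) : Nbar n := [ffun y => (y == x)%:R].

Definition b : Nbar n := basis_vec None.

(* Basis vector if j < k, and the junk value 0 otherwise. *)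
Definition w (j k : 'I_n) : Nbar n :=
  if insub (j, k) is Some p then basis_vec (Some p) else 0.

(* For the generator sigma_i, [lo i] and [hi i] are the strands i and i+1. *)
Definition lo i : 'I_n := widen_ord (leq_pred n) i.

Lemma hi_subproof i : (i.+1 < n)%N.
Proof. by rewrite -ltn_predRL. Qed.

Definition hi i : 'I_n := Ordinal (hi_subproof i).

(* Images of the basis elements under sigma_i (e = false) and under its inverse
   (e = true); see [gen_actK]. *)
Definition gen_img (a : 'I_n.-1 * bool) (x : Nindex n) : Nbar n :=
  let: (i, e) := a in
  match x with
  | None => b + ((-1) ^+ e * 'X) *: w (lo i) (hi i)
  | Some p => let: (j, k) := val p in
      if (j == lo i) && (k == hi i) then w j k
      else if j == hi i then w (lo i) k
      else if j == lo i then w (hi i) k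
      else if k == hi i then w j (lo i)
      else if k == lo i then w j (hi i)
      else w j k
  end.

Definition gen_act (a : 'I_n.-1 * bool) v : Nbar n :=
  \sum_x v x *: gen_img a x.

Lemma gen_act_is_linear a : linear (gen_act a).
Proof.
move=> c u v; rewrite /gen_act scaler_sumr -big_split /=.
by apply: eq_bigr => x _; rewrite !ffunE scalerDl scalerA.
Qed.
HB.instance Definition _ a :=
  GRing.isLinear.Build _ _ _ _ (gen_act a) (gen_act_is_linear a).

Lemma gen_actDZ a u c v : gen_act a (u + c *: v) = gen_act a u + c *: gen_act a v.
Proof. by rewrite linearD linearZ. Qed.

Lemma gen_act_basis a x : gen_act a (basis_vec x) = gen_img a x.
Proof.
rewrite /gen_act (bigD1 x) //= big1 ?addr0 => [|y yx].
  by rewrite ffunE eqxx scale1r.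
by rewrite ffunE (negPf yx) scale0r.
Qed.

Lemma Nbar_sum_basis v : v = \sum_x v x *: basis_vec x.
Proof.
apply/ffunP => y; rewrite sum_ffunE (bigD1 y) //= big1 ?addr0 => [|x xy].
  by rewrite !ffunE eqxx /GRing.scale /= mulr1.
by rewrite !ffunE eq_sym (negPf xy) /GRing.scale /= mulr0.
Qed.

Lemma basis_vec_w (p : {p : 'I_n * 'I_n | (p.1 < p.2)%N}) :
  basis_vec (Some p) = w (val p).1 (val p).2.
Proof. by rewrite /w -surjective_pairing valK. Qed.

Lemma Nbar_linear_ext (f g : {linear Nbar n -> Nbar n}) :
  f b = g b -> (forall j k, (j < k)%N -> f (w j k) = g (w j k)) -> f =1 g.
Proof.
move=> fgb fgw v; rewrite [v]Nbar_sum_basis !linear_sum /=.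
apply: eq_bigr => -[p|] _; rewrite !linearZ /=; congr (_ *: _); last exact: fgb.
by rewrite basis_vec_w (fgw _ _ (valP p)).
Qed.

Lemma gen_act_b i e :
  gen_act (i, e) b = b + ((-1) ^+ e * 'X) *: w (lo i) (hi i).
Proof. exact: gen_act_basis. Qed.

Lemma gen_act_w i e j k : (j < k)%N ->
  gen_act (i, e) (w j k) =
    if (j == lo i) && (k == hi i) then w j k
    else if j == hi i then w (lo i) k
    else if j == lo i then w (hi i) k
    else if k == hi i then w j (lo i)
    else if k == lo i then w j (hi i)
    else w j k.
Proof.
move=> jk; pose p : {p : 'I_n * 'I_n | (p.1 < p.2)%N} := exist _ (j, k) jk.
by rewrite -[w j k in LHS](basis_vec_w p) gen_act_basis.
Qed.

Lemma w_eq0 j k : (k <= j)%N -> w j k = 0.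
Proof. by move=> kj; rewrite /w insubF //= ltnNge kj. Qed.

Definition swap i j := if j == lo i then hi i else if j == hi i then lo i else j.

(* The basis vector attached to the unordered pair {j, k}. *)
Definition wu j k := w j k + w k j.

Lemma wuC j k : wu j k = wu k j.
Proof. by rewrite /wu addrC. Qed.

Lemma wuE j k : (j < k)%N -> wu j k = w j k.
Proof. by move=> jk; rewrite /wu (w_eq0 (ltnW jk)) addr0. Qed.

Lemma swap_val i j :
  swap i j = (if j == i :> nat then i.+1 else if j == i.+1 :> nat then i : nat else j)
    :> nat.
Proof.
by rewrite /swap -!(inj_eq val_inj) /=; case: eqP => // _; case: eqP.
Qed.

Lemma swap_valP i j :
  [\/ j = i :> nat /\ swap i j = i.+1 :> nat,
      j = i.+1 :> nat /\ swap i j = i :> nat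
    | j <> i :> nat /\ j <> i.+1 :> nat /\ swap i j = j :> nat].
Proof.
rewrite swap_val; case: eqP => [ji|ji]; first by constructor 1.
by case: eqP => [ji'|ji']; [constructor 2|constructor 3].
Qed.

Local Ltac swap_lia :=
  repeat match goal with |- context [swap ?i ?j] =>
    move: (swap_valP i j); generalize (swap i j) => ?
  end;
  rewrite /=;
  repeat (case=> [[? ?]|[? ?]|[? [? ?]]]; try (exfalso; lia));
  lia.

Lemma swapK i : involutive (swap i).
Proof. by move=> j; apply: val_inj => /=; swap_lia. Qed.

Lemma swap_lo i : swap i (lo i) = hi i.
Proof. by rewrite /swap eqxx. Qed.

Lemma swap_hi i : swap i (hi i) = lo i.
Proof. by rewrite -swap_lo swapK. Qed.

Lemma swap_comm (i j : 'I_n.-1) k : (i.+1 < j)%N ->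
  swap i (swap j k) = swap j (swap i k).
Proof. by move=> ij; apply: val_inj => /=; swap_lia. Qed.

Lemma swap_braid (i j : 'I_n.-1) k : j = i.+1 :> nat ->
  swap i (swap j (swap i k)) = swap j (swap i (swap j k)).
Proof. by move=> ij; apply: val_inj => /=; swap_lia. Qed.

Lemma swap_inj i : injective (swap i).
Proof. exact/can_inj/swapK. Qed.

Lemma gen_act_wu i e j k : j != k ->
  gen_act (i, e) (wu j k) = wu (swap i j) (swap i k).
Proof.
wlog jk : j k / (j < k)%N.
  move=> H jk; case: (ltngtP j k) => [lt_jk|lt_kj|/val_inj E]; first exact: H.
    by rewrite wuC [RHS]wuC H // eq_sym.
  by rewrite E eqxx in jk.
move=> _; rewrite wuE // gen_act_w //.
have [/andP[/eqP jE /eqP kE]|] := ifPn.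
  have -> : swap i j = k by rewrite /swap jE eqxx kE.
  have -> : swap i k = j.
    by rewrite /swap kE jE eqxx; case: eqP => // /(congr1 val) /=; lia.
  by rewrite wuC wuE.
rewrite -!(inj_eq val_inj) /= => H.
have key j' k' : (j' < k')%N -> swap i j = j' -> swap i k = k' ->
    w j' k' = wu (swap i j) (swap i k) by move=> ? -> ->; rewrite wuE.
do 4?[case: eqP => ?]; apply: key; try apply: val_inj;
  rewrite /= ?swap_val /=; move: H jk; do ?case: eqP => ?; lia.
Qed.

Lemma lo_neq_hi i : lo i != hi i.
Proof. by rewrite -(inj_eq val_inj) /= ltn_eqF. Qed.

Lemma gen_act_bu i e :
  gen_act (i, e) b = b + ((-1) ^+ e * 'X) *: wu (lo i) (hi i).
Proof. by rewrite wuE ?gen_act_b. Qed.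

Lemma gen_actK i e : cancel (gen_act (i, ~~ e)) (gen_act (i, e)).
Proof.
move=> v; pose f := gen_act (i, e) \o gen_act (i, ~~ e).
rewrite -[LHS]/(f v); move: v; apply: (@Nbar_linear_ext f idfun) => /=.
  rewrite /f /= gen_act_bu linearD linearZ /= gen_act_bu gen_act_wu ?lo_neq_hi //.
  rewrite swap_lo swap_hi wuC -addrA -scalerDl; clear f; case: e; rewrite /= ?expr1 ?expr0.
    by rewrite mulN1r mul1r addNr scale0r addr0.
  by rewrite mulN1r mul1r subrr scale0r addr0.
move=> j k jk; have jDk : j != k by rewrite -(inj_eq val_inj) ltn_eqF.
rewrite /f /= -wuE // !gen_act_wu ?(inj_eq (@swap_inj i)) //.
by rewrite !swapK.
Qed.

(* Left action: the rightmost letter acts first. *)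
Definition word_act (u : braid_word n) v : Nbar n := foldr gen_act v u.

Lemma word_act_is_linear u : linear (word_act u).
Proof.
move=> c x y; elim: u => [//|a u IHu].
by rewrite /word_act /= -/(word_act u _) IHu linearP.
Qed.
HB.instance Definition _ u :=
  GRing.isLinear.Build _ _ _ _ (word_act u) (word_act_is_linear u).

Lemma word_act_wu u j k : j != k ->
  word_act u (wu j k) =
    let s := foldr (fun a => swap a.1) ^~ u in wu (s j) (s k).
Proof.
move=> jk /=; elim: u => [//|[i e] u /= ->]; rewrite gen_act_wu //.
by elim: u => [//|a u IHu]; rewrite /= (inj_eq (@swap_inj _)).
Qed.

Lemma word_act_comm (i j : 'I_n.-1) : (i.+1 < j)%N ->
  word_act [:: (i, false); (j, false)] =1 word_act [:: (j, false); (i, false)].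
Proof.
move=> ij; apply: Nbar_linear_ext => [|k l kl].
  rewrite /word_act /= !gen_act_bu !gen_actDZ !gen_act_bu.
  rewrite !(gen_act_wu _ _ (lo_neq_hi _)).
  have Ei k : k != lo i -> k != hi i -> swap i k = k.
    by rewrite /swap => /negPf -> /negPf ->.
  have Ej k : k != lo j -> k != hi j -> swap j k = k.
    by rewrite /swap => /negPf -> /negPf ->.
  have [E1 E2] : swap i (lo j) = lo j /\ swap i (hi j) = hi j.
    by split; apply: Ei; rewrite -(inj_eq val_inj) /=; lia.
  have [E3 E4] : swap j (lo i) = lo i /\ swap j (hi i) = hi i.
    by split; apply: Ej; rewrite -(inj_eq val_inj) /=; lia.
  rewrite E1 E2 E3 E4; exact: addrAC.
have kDl : k != l by rewrite -(inj_eq val_inj) ltn_eqF.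
rewrite -(wuE kl).
change (word_act [:: (i, false); (j, false)] (wu k l) =
        word_act [:: (j, false); (i, false)] (wu k l)).
rewrite !(word_act_wu _ kDl) /=.
by rewrite !(swap_comm _ ij).
Qed.

Lemma word_act_braid (i j : 'I_n.-1) : j = i.+1 :> nat ->
  word_act [:: (i, false); (j, false); (i, false)] =1
  word_act [:: (j, false); (i, false); (j, false)].
Proof.
move=> ij; apply: Nbar_linear_ext => [|k l kl] /=.
  have D (k l : 'I_n.-1) : swap k (lo l) != swap k (hi l).
    by rewrite (inj_eq (@swap_inj k)) lo_neq_hi.
  rewrite /word_act /= !gen_act_bu !gen_actDZ !gen_act_bu !gen_actDZ !gen_act_bu.
  rewrite !(gen_act_wu _ _ (lo_neq_hi _)) !(gen_act_wu _ _ (D _ _)).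
  have Ei : hi i = lo j by apply: val_inj.
  have E1 : swap j (lo i) = lo i.
    by rewrite /swap -!(inj_eq val_inj) /= ij !ltn_eqF //; lia.
  have E2 : swap i (hi j) = hi j.
    by rewrite /swap -!(inj_eq val_inj) /= ij !gtn_eqF //; lia.
  have E3 : swap i (lo j) = lo i by rewrite -Ei swap_hi.
  have E4 : swap i (lo i) = lo j by rewrite swap_lo.
  have W1 : wu (swap i (swap j (lo i))) (swap i (swap j (hi i))) = wu (lo j) (hi j).
    by rewrite E1 E4 Ei swap_lo E2.
  have W2 : wu (swap j (swap i (lo j))) (swap j (swap i (hi j))) = wu (lo i) (hi i).
    by rewrite E3 E1 E2 swap_hi Ei.
  have W3 : wu (swap i (lo j)) (swap i (hi j)) = wu (swap j (lo i)) (swap j (hi i)).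
    by rewrite E3 E1 E2 Ei swap_lo.
  have C (V : zmodType) (x p q r : V) : x + p + q + r = x + r + q + p.
    by rewrite addrAC [x + p + r]addrAC addrAC.
  rewrite W1 W2 W3; exact: C.
have kDl : k != l by rewrite -(inj_eq val_inj) ltn_eqF.
rewrite -(wuE kl).
change (word_act [:: (i, false); (j, false); (i, false)] (wu k l) =
        word_act [:: (j, false); (i, false); (j, false)] (wu k l)).
rewrite !(word_act_wu _ kDl) /=.
by rewrite !(swap_braid _ ij).
Qed.

Lemma word_act_conv u u' : braid_conv u u' -> word_act u =1 word_act u'.
Proof.
elim=> {u u'} [u|u u' _ IH|u1 u2 u3 _ IH1 _ IH2|u u' v v' _ IHu _ IHv|i e|i j|i j] x.
- by [].
- by rewrite IH.
- by rewrite IH1 IH2.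
- by rewrite /word_act !foldr_cat -!/(word_act _ _) IHv IHu.
- exact: gen_actK.
- by move=> ?; exact: word_act_comm.
- by move=> ?; exact: word_act_braid.
Qed.

Definition Nbar_rep (x : braid n) : {linear Nbar n -> Nbar n} :=
  word_act (repr x).

Lemma Nbar_rep_class u : Nbar_rep (braid_class u) =1 word_act u.
Proof. exact/word_act_conv/repr_braid_class. Qed.

Lemma Nbar_rep1 : Nbar_rep 1%g =1 id.
Proof. exact: Nbar_rep_class. Qed.

Lemma Nbar_repM x y : Nbar_rep (x * y)%g =1 Nbar_rep x \o Nbar_rep y.
Proof. by move=> v; rewrite Nbar_rep_class /word_act foldr_cat. Qed.

Lemma Nbar_rep_sigma_b i : Nbar_rep (sigma i) b = b + 'X *: w (lo i) (hi i).
Proof. by rewrite Nbar_rep_class /word_act /= gen_act_b mul1r. Qed.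

Lemma Nbar_rep_sigma_disjoint i j k : (j < k)%N ->
  j != lo i -> j != hi i -> k != lo i -> k != hi i ->
  Nbar_rep (sigma i) (w j k) = w j k.
Proof.
move=> jk /negPf j1 /negPf j2 /negPf k1 /negPf k2.
by rewrite Nbar_rep_class /word_act /= gen_act_w // j1 j2 k1 k2.
Qed.

Lemma Nbar_rep_sigma_hi_l i k : (hi i < k)%N ->
  Nbar_rep (sigma i) (w (hi i) k) = w (lo i) k.
Proof.
move=> ik; rewrite Nbar_rep_class /word_act /= gen_act_w // eqxx.
by rewrite -(inj_eq val_inj) /= gtn_eqF.
Qed.

Lemma Nbar_rep_sigma_lo_l i k : (hi i < k)%N ->
  Nbar_rep (sigma i) (w (lo i) k) = w (hi i) k.
Proof.
move=> ik; rewrite Nbar_rep_class /word_act /= gen_act_w ?(ltnW ik) // eqxx.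
by rewrite -!(inj_eq val_inj) /= (gtn_eqF ik) ltn_eqF.
Qed.

Lemma Nbar_rep_sigma_hi_r i j : (j < lo i)%N ->
  Nbar_rep (sigma i) (w j (hi i)) = w j (lo i).
Proof.
move=> ji; rewrite Nbar_rep_class /word_act /= gen_act_w ?(ltnW ji) // ?eqxx.
  by rewrite -!(inj_eq val_inj) /= (ltn_eqF ji) ltn_eqF // ltnW.
exact: ltnW.
Qed.

Lemma Nbar_rep_sigma_lo_r i j : (j < lo i)%N ->
  Nbar_rep (sigma i) (w j (lo i)) = w j (hi i).
Proof.
move=> ji; rewrite Nbar_rep_class /word_act /= gen_act_w // eqxx.
rewrite -!(inj_eq val_inj) /= (ltn_eqF ji) !ltn_eqF //.
exact: ltnW.
Qed.

Lemma Nbar_rep_sigma_lo_hi i :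
  Nbar_rep (sigma i) (w (lo i) (hi i)) = w (lo i) (hi i).
Proof. by rewrite Nbar_rep_class /word_act /= gen_act_w // !eqxx. Qed.

End Representation.

Arguments b {n}.

(* Main.v *)
Require Import Defs.
From mathcomp Require Import all_boot all_order all_algebra.
From mathcomp Require Import zify.
From mathcomp Require Import boolp classical_sets.

(** Let [W] be the sum of all the [w_{j,k}]. The braid group permutes the
    [w_{j,k}], so it fixes [W]. Since [delta_m] sends [b] to
    [b + t sum_(1 < k <= m) w_{1,k}] and shifts [w_{j,k}] to [w_{j+1,k+1}] for
    [k < m], an induction gives [Delta b = b + t W], hence
    [Delta^k b = b + k t W]. Faithfulness follows because [t W] has a nonzero
    coordinate and the integers embed in [Z[t]]. *)

Set Implicit Arguments.
Unset Strict Implicit.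
Unset Printing Implicit Defensive.

Import GRing.Theory.
Local Open Scope classical_set_scope.
Local Open Scope ring_scope.

Definition sum_w (n : nat) : Nbar n := \sum_(i < n) \sum_(j < n | (i < j)%N) w i j.

Lemma Nbar_double_eq0 (n : nat) (v : Nbar n) : v + v = 0 -> v = 0.
Proof.
move=> /ffunP v0; apply/ffunP => x; move: (v0 x); rewrite !ffunE => vx0.
(* The false disjunct [2 == 0] gives the goal the shape of [mulrn_eq0], so halving is done on
   integer coefficients. *)
apply/polyP => i; apply/eqP; rewrite coef0 -[_ == 0]/((2 == 0)%N || _).
by rewrite -Num.Theory.mulrn_eq0 mulr2n -coefD vx0 coef0.
Qed.

Lemma sum_wE (n : nat) : sum_w n = \sum_i \sum_j w i j.
Proof.
apply: eq_bigr => i _; rewrite big_mkcond; apply: eq_bigr => j _.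
by case: ltnP => // ji; rewrite w_eq0.
Qed.

Lemma wu_diag (n : nat) (j : 'I_n) : wu j j = 0.
Proof. by rewrite /wu w_eq0 // addr0. Qed.

Lemma sum_wu (n : nat) : \sum_i \sum_j wu i j = sum_w n + sum_w n.
Proof.
under eq_bigr => i _ do rewrite big_split /=.
by rewrite big_split /= [X in _ + X]exchange_big -!sum_wE.
Qed.

(* [2 W] is the sum of [wu j k] over all ordered pairs, a range which [swap]
   permutes, whereas [swap] does not preserve the range [j < k] of [W]. *)
Lemma gen_act_sum_w (n : nat) (a : 'I_n.-1 * bool) : gen_act a (sum_w n) = sum_w n.
Proof.
case: a => i e; apply/eqP; rewrite -subr_eq0; apply/eqP/Nbar_double_eq0.
rewrite addrACA -opprD -raddfD /= -sum_wu linear_sum /=; apply/eqP.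
rewrite subr_eq0; apply/eqP.
rewrite [RHS](reindex_inj (@swap_inj _ i)); apply: eq_bigr => j _.
rewrite linear_sum [RHS](reindex_inj (@swap_inj _ i)); apply: eq_bigr => k _ /=.
have [->|jDk] := eqVneq j k; first by rewrite !wu_diag linear0.
exact: gen_act_wu.
Qed.

Lemma Nbar_rep_sum_w (n : nat) (x : braid n) : Nbar_rep x (sum_w n) = sum_w n.
Proof.
rewrite /Nbar_rep /word_act /=.
by elim: (repr x) => //= a u ->; apply: gen_act_sum_w.
Qed.

(** Since [sum_w n] is fixed by every braid, its coefficient is additive under composition. *)
Lemma Nbar_rep_mul_b (n : nat) (x y : braid n) (c d : {poly int}) :
  Nbar_rep x b = b + c *: sum_w n -> Nbar_rep y b = b + d *: sum_w n ->
  Nbar_rep (x * y)%g b = b + (c + d) *: sum_w n.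
Proof.
move=> xb yb; rewrite Nbar_repM /= yb linearD linearZ /= Nbar_rep_sum_w xb.
by rewrite -addrA -scalerDl.
Qed.

Lemma Nbar_rep_inv_b (n : nat) (x : braid n) (c : {poly int}) :
  Nbar_rep x b = b + c *: sum_w n -> Nbar_rep (x^-1)%g b = b + (- c) *: sum_w n.
Proof.
move=> xb; rewrite scaleNr; apply: (canRL (addrK _)).
(* Replacing [sum_w n] by its image under [x^-1] turns the left side into [x^-1] applied to
   [x b]. *)
rewrite -[X in _ + _ *: X](Nbar_rep_sum_w x^-1%g) -linearZ -linearD -xb.
by rewrite -[LHS]/((Nbar_rep x^-1%g \o Nbar_rep x) b) -Nbar_repM mulVg Nbar_rep1.
Qed.

Lemma Nbar_rep_exp_b (n : nat) (x : braid n) (c : {poly int}) (m : nat) :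
  Nbar_rep x b = b + c *: sum_w n ->
  Nbar_rep (x ^+ m)%g b = b + (m%:R * c) *: sum_w n.
Proof.
move=> xb; elim: m => [|m IHm].
  by rewrite mul0r scale0r addr0 Nbar_rep1.
by rewrite expgS (Nbar_rep_mul_b xb IHm) -nat1r mulrDl mul1r.
Qed.

(* Strands indexed by natural numbers: [inord] gives a junk value from [n.+2] on
   for [wn] and from [n.+1] on for [sigman]. *)
Definition wn (n j k : nat) : Nbar n.+2 := wu (inord j) (inord k).

Definition sigman (n i : nat) : braid n.+2 := @sigma n.+2 (inord i : 'I_n.+1).

Lemma sigman_b (n i : nat) : (i <= n)%N ->
  Nbar_rep (sigman n i) b = b + 'X *: wn n i i.+1.
Proof.
move=> ile; rewrite Nbar_rep_sigma_b /wn -wuE; last exact: ltnSn.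
by congr (_ + _ *: wu _ _); apply: val_inj; rewrite /= !inordK //; lia.
Qed.

Lemma sigman_wn (n i j k j' k' : nat) : (i <= n)%N -> j != k ->
  (j < n.+2)%N -> (k < n.+2)%N ->
  j' = (if j == i then i.+1 else if j == i.+1 then i else j) ->
  k' = (if k == i then i.+1 else if k == i.+1 then i else k) ->
  Nbar_rep (sigman n i) (wn n j k) = wn n j' k'.
Proof.
move=> ile jDk jn kn -> ->.
rewrite Nbar_rep_class /word_act /= gen_act_wu; last first.
  by rewrite -(inj_eq val_inj) /= !inordK.
by rewrite /wn; congr wu; apply: val_inj; rewrite /= swap_val /= !inordK //;
  do !case: eqP => //; lia.
Qed.

Lemma deltaE (n m : nat) : (m <= n.+1)%N ->
  delta n.+2 m.+1 = (\prod_(0 <= i < m) sigman n i)%g.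
Proof.
move=> mn; rewrite /delta big_mkord (big_ord_narrow mn).
by apply: eq_bigr => i _; rewrite /sigman -[i : nat]/(widen_ord mn i : nat) inord_val.
Qed.

(** Inductive step of [suffix_wn]: opening a gap at [a] amounts to opening it at [a.+1], then
    swapping [a] and [a.+1]. *)
Lemma bump_swap (a j : nat) :
  bump a j = (if bump a.+1 j == a then a.+1
              else if bump a.+1 j == a.+1 then a else bump a.+1 j).
Proof. by rewrite /bump; case: eqP => ?; [lia|case: eqP => ?; lia]. Qed.

(** Induction on the length [m - a]: the leftmost factor [sigman n a] is peeled off and acts last.
    The case [a = 0] is the shift by [delta]. *)
Lemma suffix_wn (n m a j k : nat) : (m <= n.+1)%N -> (a <= m)%N -> j != k ->
  (j < m)%N -> (k < m)%N ->
  Nbar_rep (\prod_(a <= i < m) sigman n i)%g (wn n j k) = wn n (bump a j) (bump a k).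
Proof.
move=> mn am jDk jm km; rewrite -(subKn am); move: (leq_subr a m).
elim: (m - a)%N => [|d IHd] dm.
  rewrite subn0 (big_geq (leqnn m)) Nbar_rep1 /bump.
  by rewrite [(m <= j)%N]leqNgt [(m <= k)%N]leqNgt jm km.
rewrite big_ltn; last lia.
have E : (m - d.+1).+1 = (m - d)%N by lia.
rewrite E Nbar_repM /= IHd; last lia.
by apply: sigman_wn; rewrite -?E -?bump_swap // /bump; lia.
Qed.

(** The new leftmost factor [sigman n a] adds the term [k = a.+1] when acting on [b], and turns each
    earlier [wn n a.+1 k] into [wn n a k]. *)
Lemma suffix_b (n m a : nat) : (m <= n.+1)%N -> (a <= m)%N ->
  Nbar_rep (\prod_(a <= i < m) sigman n i)%g b =
  b + 'X *: \sum_(a.+1 <= k < m.+1) wn n a k.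
Proof.
move=> mn am; rewrite -(subKn am); move: (leq_subr a m).
elim: (m - a)%N => [|d IHd] dm.
  by rewrite subn0 !big_geq // Nbar_rep1 scaler0 addr0.
rewrite big_ltn; last lia.
rewrite [in RHS]big_ltn; last lia.
have -> : (m - d.+1).+1 = (m - d)%N by lia.
rewrite Nbar_repM /= IHd; last lia.
rewrite linearD linearZ linear_sum /= sigman_b; last lia.
rewrite -addrA -scalerDr; congr (_ + _ *: (wn _ _ _ + _)); first lia.
apply: eq_big_nat => k Hk.
by apply: sigman_wn; do ?case: eqP; lia.
Qed.

(** The leftmost [delta] acts last: on [b] it creates the row [j = 0], and its shift moves the pairs
    obtained so far onto the remaining rows. *)
Lemma prod_delta_b (n m : nat) : (m <= n.+1)%N ->
  Nbar_rep (\prod_(i < m) delta n.+2 (m.+1 - i))%g b =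
  b + 'X *: \sum_(0 <= j < m.+1) \sum_(j.+1 <= k < m.+1) wn n j k.
Proof.
elim: m => [|m IHm] mn.
  by rewrite big_ord0 Nbar_rep1 big_nat1 big_geq // scaler0 addr0.
rewrite big_ord_recl subn0 Nbar_repM /=.
under eq_bigr => i _ do rewrite /= /bump subSS.
rewrite IHm; last lia.
rewrite (deltaE mn) linearD linearZ linear_sum /= (suffix_b mn (leq0n _)).
rewrite -addrA -scalerDr; congr (_ + _ *: _).
rewrite [RHS]big_ltn //; congr (_ + _).
rewrite [RHS]big_add1; apply: eq_big_nat => j Hj.
rewrite linear_sum [RHS]big_add1; apply: eq_big_nat => k Hk /=.
by apply: (suffix_wn mn); lia.
Qed.

Lemma sum_w_wn (n : nat) :
  sum_w n.+2 = \sum_(0 <= j < n.+2) \sum_(j.+1 <= k < n.+2) wn n j k.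
Proof.
rewrite big_mkord; apply: eq_bigr => j _.
rewrite big_geq_mkord; apply: eq_bigr => k jk.
by rewrite /wn !inord_val wuE.
Qed.

Lemma Delta_b (n : nat) : (2 <= n)%N -> Nbar_rep (Delta n) b = b + 'X *: sum_w n.
Proof.
case: n => [|[|n]] // _; by rewrite /Delta (prod_delta_b (leqnn n.+1)) sum_w_wn.
Qed.

(** A difference of two natural exponents avoids case splits on signs in the closure properties. *)
Lemma generated1_div (G : groupType) (g x : G) : generated [set g] x ->
  exists m p : nat, x = (g ^+ m / g ^+ p)%g.
Proof.
move: x; apply: smallest_sub => [|_ ->]; last by exists 1%N, 0%N; rewrite invg1 mulg1.
split=> [|_ _ [m [p ->]] [m' [p' ->]]|_ [m [p ->]]].
- by exists 0%N, 0%N; rewrite mulgV.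
- exists (m + m')%N, (p' + p)%N; rewrite !expgnDr invgM !mulgA; congr (_ * _)%g.
  rewrite -!mulgA; congr (_ * _)%g.
  exact/esym/commuteV/commuteX2/commute_refl.
- by exists p, m; rewrite invgM invgK.
Qed.

Lemma sum_w_Some (n : nat) (p : {p : 'I_n * 'I_n | (p.1 < p.2)%N}) :
  sum_w n (Some p) = 1.
Proof.
rewrite /sum_w sum_ffunE (bigD1 (val p).1) //= sum_ffunE (bigD1 (val p).2) ?(valP p) //=.
rewrite -basis_vec_w ffunE eqxx big1 => [|j /andP[pj jp]].
  rewrite addr0 big1 ?addr0 // => i ip; rewrite sum_ffunE big1 // => j ij.
  rewrite -(basis_vec_w (exist _ (i, j) ij)) ffunE; case: eqP => // -[E].
  by rewrite E eqxx in ip.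
rewrite -(basis_vec_w (exist _ ((val p).1, j) pj)) ffunE; case: eqP => // -[E].
by rewrite E eqxx in jp.
Qed.

Theorem proposition5p15 (n : nat) (n_ge2 : (2 <= n)%N) :
  faithful_on (generated [set Delta n]) (@Nbar_rep n) /\
  (forall k : int,
     Nbar_rep (expgz (Delta n) k) b =
     b + (k%:~R * 'X) *: \sum_(i < n) \sum_(j < n | (i < j)%N) w i j).
Proof.
have Db := Delta_b n_ge2.
have Dmb m := Nbar_rep_exp_b m Db.
split=> [x y|[m|m]]; last 2 first.
- exact: Dmb.
- by rewrite (Nbar_rep_inv_b (Dmb _)) NegzE mulrNz mulNr.
move=> /generated1_div[m [p ->]] /generated1_div[m' [p' ->]].
have Dmpb q r := Nbar_rep_mul_b (Dmb q) (Nbar_rep_inv_b (Dmb r)).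
move=> /(_ b); rewrite !Dmpb => /addrI/ffunP.
(* The coordinate at the first two strands, which exist as [n >= 2], recovers the scalar. *)
have lt01 : (Ordinal (ltnW n_ge2) < Ordinal n_ge2)%N by [].
move=> /(_ (Some (exist _ (_, _) lt01))); rewrite !ffunE sum_w_Some.
rewrite /GRing.scale /= !mulr1 -!mulrBl => /(mulIf (negbT (polyX_eq0 _))) E.
have {E} E : (m + p' = m' + p)%N.
  (* Both sides are constant polynomials, so evaluation at 0 loses nothing. *)
  move/(congr1 (fun q : {poly int} => q.[0])): E.
  rewrite !hornerE !hornerMn !hornerE !natz; lia.
(* This factor clears both denominators. *)
apply: (mulIg (Delta n ^+ (p + p'))%g).
rewrite {1}expgnDr addnC expgnDr !mulgA !divgK.
by rewrite -!expgnDr E.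
Qed.
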